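(* The axioms and axiom schemes $(1)$–$(14)$ listed in the context do not form an axiomatization of $\mathbf{BA}_2$. That is, the set of first-order sentences in the language $\{=,+,V_2\}$ that are logical consequences of $(1)$–$(14)$ is not equal to $\mathbf{BA}_2=\mathrm{Th}(\mathbb{N};=,+,V_2)$.
   Context: Here $\mathbb{N}=\{0,1,2,\ldots\}$, and $V_2\colon\mathbb{N}\to\mathbb{N}$ is the unary function with $V_2(0)=0$ and, for $x>0$, $V_2(x)$ equal to the largest power of $2$ dividing $x$ (the power $2^k$ itself, not the exponent $k$). The Büchi arithmetic $\mathbf{BA}_2$ is the complete first-order theory $\mathrm{Th}(\mathbb{N};=,+,V_2)$. The axioms are formulated in the first-order language $\{=,+,<,0,1,\{\equiv_n\}_{n=2}^{\infty},V_2\}$, where $+$ is a binary function symbol, $V_2$ is a unary function symbol, $0,1$ are constants, and $<$ and each $\equiv_n$ ($n\ge 2$) are binary relation symbols. For a standard natural number $n$, $\underline{n}$ abbreviates $1+\cdots+1$ ($n$ times), and $\underline{n}u$ abbreviates $u+\cdots+u$ ($n$ times). All free variables are understood as universally quantified, and $(4)$ and $(11)$ are schemes over all standard $n\ge 2$. The axioms are: (1) $x=0\leftrightarrow\forall y\,(x+y=y)$ (2) $x<y\leftrightarrow\exists z\,((x+z=y)\wedge\neg(z=0))$ (3) $x=1\leftrightarrow 0<x\wedge\neg\exists z\,(0<z\wedge z<x)$ (4) $x\equiv_n y\leftrightarrow\exists u\,(x=\underline{n}u+y\vee y=\underline{n}u+x)$ (5) $\neg(x+1=0)$ (6) $x+z=y+z\rightarrow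 x=y$ (7) $(x+y)+z=x+(y+z)$ (8) $x=0\vee\exists y\,(x=y+1)$ (9) $x+y=y+x$ (10) $x<y\vee x=y\vee y<x$ (11) $(x\equiv_n 0)\vee(x\equiv_n 1)\vee\ldots\vee(x\equiv_n\underline{n-1})$ (12) $V_2(x)=0\leftrightarrow x=0$ (13) $\neg\exists t\,(t+t=x)\rightarrow V_2(x)=1$ (14) $\forall t\,(t+t=x\rightarrow V_2(x)=V_2(t)+V_2(t))$ *)

(* Defs.v *)
From Stdlib Require Vector.
From mathcomp Require Import all_boot.

Set Implicit Arguments.
Unset Strict Implicit.
Unset Printing Implicit Defensive.

Import Vector.VectorNotations.

(* Symbols are indexed by their arity. Equality is not a symbol of the
   signature but a logical one, always interpreted as identity. *)
Record signature := Signature {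
  func : nat -> Set;
  rel : nat -> Set
}.

(* Variables are named by natural numbers. *)
Inductive term (L : signature) : Set :=
| Var (v : nat)
| App (n : nat) (f : func L n) (args : Vector.t (term L) n).
Arguments Var {L} v.

Inductive formula (L : signature) : Set :=
| Eq (s t : term L)
| Rel (n : nat) (r : rel L n) (args : Vector.t (term L) n)
| Neg (p : formula L)
| And (p q : formula L)
| Or (p q : formula L)
| Imp (p q : formula L)
| All (v : nat) (p : formula L)
| Ex (v : nat) (p : formula L).

Definition Iff L (p q : formula L) : formula L := And (Imp p q) (Imp q p).

Fixpoint occurs L (v : nat) (s : term L) : bool :=
  match s with
  | Var w => v == w
  | App _ _ args => Vector.fold_right (fun a b => occurs v a || b) args false
  end.

Fixpoint free L (v : nat) (p : formula L) : bool :=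
  match p with
  | Eq s t => occurs v s || occurs v t
  | Rel _ _ args => Vector.fold_right (fun a b => occurs v a || b) args false
  | Neg p => free v p
  | And p q | Or p q | Imp p q => free v p || free v q
  | All w p | Ex w p => (v != w) && free v p
  end.

Definition sentence L (p : formula L) : Prop := forall v, ~~ free v p.

Record structure (L : signature) := Structure {
  carrier :> Type;
  carrier_inhabited : inhabited carrier;
  interp_func : forall n, func L n -> Vector.t carrier n -> carrier;
  interp_rel : forall n, rel L n -> Vector.t carrier n -> Prop
}.

Definition update D (rho : nat -> D) (v : nat) (d : D) : nat -> D :=
  fun w => if w == v then d else rho w.

Fixpoint eval L (M : structure L) (rho : nat -> M) (s : term L) : M :=
  match s with
  | Var v => rho v
  | App _ f args => interp_func f (Vector.map (eval rho) args)
  end.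

Fixpoint sat L (M : structure L) (rho : nat -> M) (p : formula L) : Prop :=
  match p with
  | Eq s t => eval rho s = eval rho t
  | Rel _ r args => interp_rel r (Vector.map (eval rho) args)
  | Neg p => ~ sat rho p
  | And p q => sat rho p /\ sat rho q
  | Or p q => sat rho p \/ sat rho q
  | Imp p q => sat rho p -> sat rho q
  | All v p => forall d : M, sat (update rho v d) p
  | Ex v p => exists d : M, sat (update rho v d) p
  end.

(* Free variables are read as universally quantified. *)
Definition models L (M : structure L) (p : formula L) : Prop :=
  forall rho : nat -> M, sat rho p.

Definition consequence L (Gamma : formula L -> Prop) (p : formula L) : Prop :=
  forall M : structure L, (forall q, Gamma q -> models M q) -> models M p.

Definition Th L (M : structure L) (p : formula L) : Prop :=
  sentence p /\ models M p.

Record inclusion (L L' : signature) := Inclusion {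
  incl_func : forall n, func L n -> func L' n;
  incl_rel : forall n, rel L n -> rel L' n
}.

Fixpoint lift_term L L' (h : inclusion L L') (s : term L) : term L' :=
  match s with
  | Var v => Var v
  | App _ f args => App (incl_func h f) (Vector.map (lift_term h) args)
  end.

Fixpoint lift L L' (h : inclusion L L') (p : formula L) : formula L' :=
  match p with
  | Eq s t => Eq (lift_term h s) (lift_term h t)
  | Rel _ r args => Rel (incl_rel h r) (Vector.map (lift_term h) args)
  | Neg p => Neg (lift h p)
  | And p q => And (lift h p) (lift h q)
  | Or p q => Or (lift h p) (lift h q)
  | Imp p q => Imp (lift h p) (lift h q)
  | All v p => All v (lift h p)
  | Ex v p => Ex v (lift h p)
  end.

Definition V2 (x : nat) : nat := if x == 0 then 0 else 2 ^ logn 2 x.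

Inductive BA_func : nat -> Set :=
| BA_add : BA_func 2
| BA_V2 : BA_func 1.

Definition L_BA : signature := Signature BA_func (fun _ => Empty_set).

Definition BA_interp n (f : BA_func n) : Vector.t nat n -> nat :=
  match f with
  | BA_add => fun a => Vector.hd a + Vector.hd (Vector.tl a)
  | BA_V2 => fun a => V2 (Vector.hd a)
  end.

Definition N_BA : structure L_BA :=
  @Structure L_BA nat (inhabits 0) BA_interp
    (fun _ (r : Empty_set) _ => match r with end).

Definition BA2 : formula L_BA -> Prop := Th N_BA.

Inductive ax_func : nat -> Set :=
| f_zero : ax_func 0
| f_one : ax_func 0
| f_add : ax_func 2
| f_V2 : ax_func 1.

Inductive ax_rel : nat -> Set :=
| r_lt : ax_rel 2
| r_cong (n : nat) (n_ge2 : 2 <= n) : ax_rel 2.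

Definition L_ax : signature := Signature ax_func ax_rel.

Definition BA_to_ax : inclusion L_BA L_ax :=
  @Inclusion L_BA L_ax
    (fun n (f : BA_func n) =>
       match f with BA_add => f_add | BA_V2 => f_V2 end)
    (fun _ (r : Empty_set) => match r with end).

Definition tzero : term L_ax := @App L_ax 0 f_zero [].
Definition tone : term L_ax := @App L_ax 0 f_one [].
Definition tadd (s t : term L_ax) : term L_ax := @App L_ax 2 f_add [s; t].
Definition tV2 (s : term L_ax) : term L_ax := @App L_ax 1 f_V2 [s].
Definition flt (s t : term L_ax) : formula L_ax := @Rel L_ax 2 r_lt [s; t].
Definition fcong (n : nat) (n_ge2 : 2 <= n) (s t : term L_ax) : formula L_ax :=
  @Rel L_ax 2 (r_cong n_ge2) [s; t].

Declare Scope fo_scope.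
Delimit Scope fo_scope with fo.
Notation "0" := tzero : fo_scope.
Notation "1" := tone : fo_scope.
Notation "s + t" := (tadd s t) : fo_scope.
Notation "s = t" := (Eq s t) : fo_scope.
Notation "s < t" := (flt s t) : fo_scope.
Notation "~ p" := (Neg p) : fo_scope.
Notation "p /\ q" := (And p q) : fo_scope.
Notation "p \/ q" := (Or p q) : fo_scope.
Notation "p -> q" := (Imp p q) : fo_scope.
Notation "p <-> q" := (Iff p q) : fo_scope.

(* u + ... + u, n times, associated to the left; the empty sum is 0 *)
Fixpoint tmul (n : nat) (u : term L_ax) : term L_ax :=
  match n with
  | 0 => tzero
  | 1 => u
  | S m => tadd (tmul m u) u
  end.

Definition numeral (n : nat) : term L_ax := tmul n tone.

(* s = 0 mod n, or ..., or s = k mod n *)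
Fixpoint cong_upto (n : nat) (n_ge2 : 2 <= n) (s : term L_ax) (k : nat) :
    formula L_ax :=
  match k with
  | 0 => fcong n_ge2 s (numeral 0)
  | S j => Or (cong_upto n_ge2 s j) (fcong n_ge2 s (numeral k))
  end.

Section BuchiTheory.

Local Notation x := (Var 0%N).
Local Notation y := (Var 1%N).
Local Notation z := (Var 2%N).
Local Notation u := (Var 3%N).
Local Notation t := (Var 4%N).
Local Notation All_y := (All 1%N).
Local Notation All_t := (All 4%N).
Local Notation Ex_y := (Ex 1%N).
Local Notation Ex_z := (Ex 2%N).
Local Notation Ex_u := (Ex 3%N).
Local Notation Ex_t := (Ex 4%N).
Local Open Scope fo_scope.

Inductive axioms : formula L_ax -> Prop :=
| ax_zero : axioms (x = 0 <-> All_y (x + y = y))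
| ax_lt : axioms (x < y <-> Ex_z (x + z = y /\ ~ (z = 0)))
| ax_one : axioms (x = 1 <-> 0 < x /\ ~ Ex_z (0 < z /\ z < x))
| ax_cong (n : nat) (n_ge2 : (2 <= n)%N) :
    axioms (fcong n_ge2 x y <-> Ex_u (x = tmul n u + y \/ y = tmul n u + x))
| ax_succ_neq0 : axioms (~ (x + 1 = 0))
| ax_cancel : axioms (x + z = y + z -> x = y)
| ax_addA : axioms ((x + y) + z = x + (y + z))
| ax_pred : axioms (x = 0 \/ Ex_y (x = y + 1))
| ax_addC : axioms (x + y = y + x)
| ax_total : axioms (x < y \/ x = y \/ y < x)
| ax_residues (n : nat) (n_ge2 : (2 <= n)%N) :
    axioms (cong_upto n_ge2 x n.-1)
| ax_V2_zero : axioms (tV2 x = 0 <-> x = 0)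
| ax_V2_odd : axioms (~ Ex_t (t + t = x) -> tV2 x = 1)
| ax_V2_double : axioms (All_t (t + t = x -> tV2 x = tV2 t + tV2 t)).

End BuchiTheory.

Definition BA_consequences (p : formula L_BA) : Prop :=
  sentence p /\ consequence axioms (lift BA_to_ax p).

(* Main.v *)
Require Import Defs.
From Stdlib Require Vector.
From HB Require Import structures.
From mathcomp Require Import all_boot all_order all_algebra.
From mathcomp Require Import zify ring lra.

(** The axioms on [V2] determine it only on elements that some standard power
    of two fails to divide: those are [2 ^ k] times an odd element, and the
    value is [2 ^ k].  On a nonzero element divisible by every standard power of
    two the axioms only ask that [V2] be nonzero and commute with doubling.

    The counterexample is therefore a nonstandard model of Presburger
    arithmetic: the nonnegative part [cone] of the lexicographically ordered
    group [rat * int], whose positive elements [(q, 0)] are divisible by every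
    standard integer.  There the value is set to [(q + q, 0)] ([wild_V2]).  All
    axioms hold ([cone_axioms]), but applying this map twice multiplies [(q, 0)]
    by four and not by two, so the sentence [forall x, V2 (V2 x) = V2 x] fails.
    It holds in the natural numbers, where the values of [V2] are zero and the
    powers of two, all of which it fixes. *)

Set Implicit Arguments.
Unset Strict Implicit.
Unset Printing Implicit Defensive.

Import Order.TTheory GRing.Theory Num.Theory.
Local Open Scope ring_scope.

(** * The function [V2] on the natural numbers *)

Lemma V2_gt0 n : (0 < n)%N -> (0 < V2 n)%N.
Proof. by rewrite /V2 lt0n => /negPf ->; rewrite expn_gt0. Qed.

Lemma V2_double n : V2 (n + n) = (V2 n + V2 n)%N.
Proof.
rewrite /V2 addnn double_eq0; case: eqVneq => // n0.
by rewrite -mul2n lognM ?lt0n // expnD mul2n addnn.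
Qed.

Lemma V2_odd n : odd n -> V2 n = 1%N.
Proof.
move=> on; rewrite /V2 gtn_eqF ?odd_gt0 //.
by rewrite lognE dvdn2 on andbF.
Qed.

Lemma V2_idem n : V2 (V2 n) = V2 n.
Proof.
have [->|n0] := posnP n; first by [].
by rewrite {1}/V2 gtn_eqF ?V2_gt0 // /V2 gtn_eqF // pfactorK.
Qed.

(** * The nonnegative cone of the lexicographic group *)

Definition nonneg (p : rat * int) : bool :=
  (0 < p.1) || (p.1 == 0) && (0 <= p.2).

Record cone := Cone { coord : rat * int; coordP : nonneg coord }.

HB.instance Definition _ := [isSub for coord].
HB.instance Definition _ := [Equality of cone by <:].

Lemma cone_eqP (a b : cone) :
  a = b <-> (coord a).1 = (coord b).1 /\ (coord a).2 = (coord b).2.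
Proof.
split=> [-> // | [e1 e2]]; apply: val_inj => /=.
by rewrite [LHS]surjective_pairing e1 e2 -surjective_pairing.
Qed.

Lemma nonneg_nat n : nonneg (0, n%:Z).
Proof. by []. Qed.

Lemma nonneg_add (a b : cone) :
  nonneg ((coord a).1 + (coord b).1, (coord a).2 + (coord b).2).
Proof.
case: a b => [[q m] /= Ha] [[r n] /= Hb]; move: Ha Hb; rewrite /nonneg /=.
case/orP=> [a0|/andP[/eqP-> m0]] /orP[b0|/andP[/eqP-> n0]].
- by rewrite addr_gt0.
- by rewrite addr0 a0.
- by rewrite add0r b0.
- by rewrite addr0 eqxx addr_ge0 // orbT.
Qed.

Definition cone_nat n : cone := Cone (nonneg_nat n).
Definition cone_add (a b : cone) : cone := Cone (nonneg_add a b).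

(** The second branch is forced by the axioms; the first is where they leave a
    choice, and doubling is an additive map that is not idempotent. *)
Definition wild_V2_val (p : rat * int) : rat * int :=
  if p.2 == 0 then (p.1 + p.1, 0) else (0, (V2 `|p.2|)%:Z).

Lemma nonneg_wild_V2 (a : cone) : nonneg (wild_V2_val (coord a)).
Proof.
case: a => [[q m] /= Ha]; rewrite /wild_V2_val /=.
case: eqP => [m0|_]; last exact: nonneg_nat.
move: Ha; rewrite m0 /nonneg /= => /orP[q0|/andP[/eqP-> _]].
  by rewrite addr_gt0.
by rewrite addr0 eqxx orbT.
Qed.

Definition wild_V2 (a : cone) : cone := Cone (nonneg_wild_V2 a).

(** The order and the congruences of the model are taken to be the right-hand
    sides of the axioms that define them, so these axioms need no argument and
    the content moves to discreteness, totality and residues. *)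
Definition cone_lt (a b : cone) : Prop :=
  exists c, cone_add a c = b /\ c <> cone_nat 0.

Fixpoint cone_mul (n : nat) (a : cone) : cone :=
  match n with
  | 0 => cone_nat 0
  | 1 => a
  | S m => cone_add (cone_mul m a) a
  end.

Definition cone_cong (n : nat) (a b : cone) : Prop :=
  exists c, a = cone_add (cone_mul n c) b \/ b = cone_add (cone_mul n c) a.

Lemma cone_zeroP (a : cone) :
  a = cone_nat 0 <-> forall b, cone_add a b = b.
Proof.
split=> [-> b|/(_ (cone_nat 0)) /cone_eqP /= [e1 e2]].
  by apply/cone_eqP; rewrite /= !add0r.
by apply/cone_eqP; split=> /=; lra.
Qed.

Lemma cone_succ_neq0 (a : cone) : cone_add a (cone_nat 1) <> cone_nat 0.
Proof.
move=> /cone_eqP /= [e1 e2]; have := coordP a.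
by rewrite /nonneg => /orP[|/andP[_]]; [lra | lia].
Qed.

Lemma cone_addI (a b c : cone) : cone_add a c = cone_add b c -> a = b.
Proof. by move=> /cone_eqP /= [/addIr e1 /addIr e2]; apply/cone_eqP. Qed.

Lemma cone_subP (a b : cone) :
  (exists c, cone_add a c = b) <->
  nonneg ((coord b).1 - (coord a).1, (coord b).2 - (coord a).2).
Proof.
split=> [[c <-] /=|H].
  have -> : (coord a).1 + (coord c).1 - (coord a).1 = (coord c).1 by ring.
  have -> : (coord a).2 + (coord c).2 - (coord a).2 = (coord c).2 by ring.
  by rewrite -surjective_pairing; exact: coordP c.
by exists (Cone H); apply/cone_eqP; rewrite /=; split; ring.
Qed.

Lemma cone_ltP (a b : cone) :
  cone_lt a b <->
  a <> b /\ nonneg ((coord b).1 - (coord a).1, (coord b).2 - (coord a).2).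
Proof.
split=> [[c [<- c0]]|[ab /cone_subP[c e]]].
  split; last by apply/cone_subP; exists c.
  move/cone_eqP=> /= [e1 e2]; apply: c0; apply/cone_eqP => /=.
  by split; lra.
exists c; split=> // c0; apply: ab; rewrite -e c0.
by apply/cone_eqP; rewrite /= !addr0.
Qed.

Lemma cone_lt_total (a b : cone) : cone_lt a b \/ a = b \/ cone_lt b a.
Proof.
have [->|/eqP ab] := eqVneq a b; first by right; left.
suff [H|H] : nonneg ((coord b).1 - (coord a).1, (coord b).2 - (coord a).2)
   \/ nonneg ((coord a).1 - (coord b).1, (coord a).2 - (coord b).2).
- by left; apply/cone_ltP.
- by right; right; apply/cone_ltP; split=> // ba; apply: ab.
rewrite /nonneg /= !subr_gt0 !subr_eq0 !subr_ge0.
case: (ltgtP (coord a).1 (coord b).1) => //= _; rewrite ?orbT; auto.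
by apply/orP; exact: le_total.
Qed.

(** A positive rational coordinate outweighs any integer one, and a zero one
    leaves a positive integer.  This makes the order discrete; the differences
    are kept in the form in which [cone_ltP] produces them. *)
Lemma cone_ge1 (a : cone) : a <> cone_nat 0 ->
  nonneg ((coord a).1 - 0, (coord a).2 - 1).
Proof.
move=> a0; have := coordP a; rewrite /nonneg /= subr0 => /orP[->//|/andP[e m0]].
have m1 : (coord a).2 <> 0.
  by move=> e2; apply: a0; apply/cone_eqP; rewrite (eqP e).
by rewrite e subr_ge0; apply/orP; right; lia.
Qed.

Lemma cone_lt0P (a : cone) : cone_lt (cone_nat 0) a <-> a <> cone_nat 0.
Proof.
rewrite cone_ltP /= !subr0 -surjective_pairing.
split=> [[H _] e|H]; first exact: H.
by split; [move=> e; apply: H | exact: coordP a].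
Qed.

Lemma cone_no_lt1 (a : cone) : a <> cone_nat 0 -> ~ cone_lt a (cone_nat 1).
Proof.
move=> a0 /cone_ltP[a1]; have {a0} := cone_ge1 a0.
rewrite /nonneg /= => H1 H2; apply: a1; apply/cone_eqP => /=.
case/orP: H1 => [|/andP[/eqP]]; case/orP: H2 => [|/andP[/eqP]];
  try by move=> *; exfalso; lra.
(* What is left is rational coordinate zero and integer coordinate 1. *)
by move=> *; split; [lra | lia].
Qed.

Lemma cone_oneP (a : cone) :
  a = cone_nat 1 <->
  cone_lt (cone_nat 0) a /\ ~ (exists b, cone_lt (cone_nat 0) b /\ cone_lt b a).
Proof.
split=> [->|[/cone_lt0P a0 H]].
  split; first by apply/cone_lt0P => /cone_eqP[].
  by case=> b [/cone_lt0P]; exact: cone_no_lt1.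
have [//|/eqP a1] := eqVneq a (cone_nat 1); case: H; exists (cone_nat 1).
split; first by apply/cone_lt0P => /cone_eqP[].
by apply/cone_ltP; split; [move=> e; apply: a1 | exact: cone_ge1].
Qed.

Lemma cone_predP (a : cone) :
  a = cone_nat 0 \/ exists b, a = cone_add b (cone_nat 1).
Proof.
have [->|/eqP a0] := eqVneq a (cone_nat 0); [by left | right].
exists (Cone (cone_ge1 a0)).
by apply/cone_eqP => /=; split; ring.
Qed.

Lemma coord_cone_mul n (a : cone) :
  coord (cone_mul n a) = ((coord a).1 *+ n, (coord a).2 *+ n).
Proof.
elim: n => [|[|n] IHn]; rewrite ?mulr0n ?mulr1n //.
  exact: surjective_pairing.
rewrite [cone_mul _ _]/(cone_add (cone_mul n.+1 a) a) /=.
by rewrite -/(cone_mul n.+1 a) IHn /= !(mulrSr _ n.+1).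
Qed.

(** Euclidean division only concerns the integer coordinate, since the rational
    one is divisible by [n]. *)
Lemma cone_residue n (a : cone) : (0 < n)%N ->
  exists2 r, (r < n)%N & cone_cong n a (cone_nat r).
Proof.
move=> n0; have nz : n%:Z != 0 by lia.
pose r := `|((coord a).2 %% n)%Z|%N.
have er : r%:Z = ((coord a).2 %% n)%Z by rewrite /r gez0_abs // modz_ge0.
exists r; first by rewrite -ltz_nat er ltz_pmod.
have nq : (0 : rat) < n%:R by rewrite ltr0n.
have H : nonneg ((coord a).1 / n%:R, ((coord a).2 %/ n)%Z).
  have := coordP a; rewrite /nonneg /= => /orP[q0|/andP[/eqP-> m0]].
    by rewrite divr_gt0.
  by rewrite mul0r eqxx divz_ge0 ?m0 ?orbT.
exists (Cone H); left; apply/cone_eqP; rewrite /= coord_cone_mul /=; split.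
  by rewrite addr0 -[_ / _ *+ _]mulr_natr divfK // gt_eqF.
by rewrite er -mulr_natr natz -divz_eq.
Qed.

(** * A nonstandard interpretation of [V2] on the cone *)

Lemma wild_V2_eq0 (a : cone) : wild_V2 a = cone_nat 0 <-> a = cone_nat 0.
Proof.
split=> [/cone_eqP|->].
  rewrite /= /wild_V2_val; case: eqP => /= [m0 [e _]|m0 [_ e]].
    by apply/cone_eqP => /=; split=> //; lra.
  have /V2_gt0 : (0 < `|(coord a).2|)%N by lia.
  by move: e; lia.
by apply/cone_eqP; rewrite /= /wild_V2_val /= addr0.
Qed.

(** The rational coordinate can always be halved, so only an odd integer
    coordinate prevents an element from being a double. *)
Lemma wild_V2_odd (a : cone) :
  ~ (exists b, cone_add b b = a) -> wild_V2 a = cone_nat 1.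
Proof.
move=> H; have o : odd `|(coord a).2|%N.
  apply/negPn/negP => o; apply: H.
  have e : ((coord a).2 %/ 2)%Z + ((coord a).2 %/ 2)%Z = (coord a).2 by lia.
  have H : nonneg ((coord a).1 / 2, ((coord a).2 %/ 2)%Z).
    have := coordP a; rewrite /nonneg /= => /orP[q0|/andP[/eqP-> m0]].
      by rewrite divr_gt0.
    by rewrite mul0r eqxx divz_ge0 ?m0 ?orbT.
  by exists (Cone H); apply/cone_eqP; split=> //=; field.
have m0 : (coord a).2 == 0 = false by lia.
by apply/cone_eqP; rewrite /= /wild_V2_val m0 /= V2_odd.
Qed.

Lemma wild_V2_double (a : cone) :
  wild_V2 (cone_add a a) = cone_add (wild_V2 a) (wild_V2 a).
Proof.
apply/cone_eqP; rewrite /= /wild_V2_val /=.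
have -> : ((coord a).2 + (coord a).2 == 0) = ((coord a).2 == 0) by lia.
case: eqP => //= m0; split; first by rewrite addr0.
have -> : `|((coord a).2 + (coord a).2)%R|%N =
          (`|(coord a).2| + `|(coord a).2|)%N by lia.
by rewrite V2_double PoszD.
Qed.

Lemma wild_V2_not_idem : exists a, wild_V2 (wild_V2 a) <> wild_V2 a.
Proof. by exists (@Cone (1, 0) isT) => /cone_eqP[]. Qed.

(** * The model *)

Definition cone_func n (f : ax_func n) : Vector.t cone n -> cone :=
  match f with
  | f_zero => fun=> cone_nat 0
  | f_one => fun=> cone_nat 1
  | f_add => fun v => cone_add (Vector.hd v) (Vector.hd (Vector.tl v))
  | f_V2 => fun v => wild_V2 (Vector.hd v)
  end.

Definition cone_rel n (r : ax_rel n) : Vector.t cone n -> Prop :=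
  match r with
  | r_lt => fun v => cone_lt (Vector.hd v) (Vector.hd (Vector.tl v))
  | r_cong k _ => fun v => cone_cong k (Vector.hd v) (Vector.hd (Vector.tl v))
  end.

Definition cone_structure : structure L_ax :=
  @Structure L_ax cone (inhabits (cone_nat 0)) cone_func cone_rel.

Lemma eval_tmul (rho : nat -> cone_structure) n s :
  eval rho (tmul n s) = cone_mul n (eval rho s).
Proof.
elim: n => [|[|n] IHn] //.
by rewrite [LHS]/(cone_add (eval rho (tmul n.+1 s)) (eval rho s)) IHn.
Qed.

Lemma eval_numeral (rho : nat -> cone_structure) n :
  eval rho (numeral n) = cone_nat n.
Proof.
rewrite /numeral eval_tmul; apply/cone_eqP; rewrite coord_cone_mul /=.
by rewrite mul0rn natz.
Qed.

Lemma sat_cong_upto (rho : nat -> cone_structure) n (n_ge2 : (2 <= n)%N) s k r :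
  (r <= k)%N -> cone_cong n (eval rho s) (cone_nat r) ->
  sat rho (cong_upto n_ge2 s k).
Proof.
move=> rk H; elim: k rk => [|k IHk].
  by rewrite leqn0 => /eqP r0; rewrite r0 in H.
rewrite leq_eqVlt => /orP[/eqP e|/IHk]; last by left.
right; rewrite -e [sat _ _]/(cone_cong n _ (eval rho (numeral r))).
by rewrite eval_numeral.
Qed.

Lemma cone_axioms q : axioms q -> models cone_structure q.
Proof.
case=> [|||n n_ge2|||||||n n_ge2|||] rho.
- exact: cone_zeroP.
- by split.
- exact: cone_oneP.
- have E d : eval (update rho 3 d) (tmul n (Var 3)) = cone_mul n d.
    by rewrite eval_tmul.
  by split=> -[d] /= H; exists d; move: H; rewrite /= E.
- exact: cone_succ_neq0.
- exact: cone_addI.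
- by apply/cone_eqP => /=; rewrite !addrA.
- exact: cone_predP.
- by apply/cone_eqP; split; rewrite /= addrC.
- exact: cone_lt_total.
- have [r rn H] := @cone_residue n (rho 0%N) (ltnW n_ge2).
  by apply: (@sat_cong_upto _ _ _ _ _ r) => //; lia.
- exact: wild_V2_eq0.
- exact: wild_V2_odd.
- by move=> d /= <-; exact: wild_V2_double.
Qed.

(** * The separating sentence *)

Definition term_V2 (s : term L_BA) : term L_BA :=
  @App L_BA 1 BA_V2 (Vector.cons _ s _ (Vector.nil _)).

Definition idem_V2 : formula L_BA :=
  All 0 (Eq (term_V2 (term_V2 (Var 0))) (term_V2 (Var 0))).

Lemma BA2_idem_V2 : BA2 idem_V2.
Proof.
split; first by move=> v /=; case: (v == _).
by move=> rho d; exact: V2_idem.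
Qed.

Theorem theorem3p1 :
  ~ (forall p : formula L_BA, BA_consequences p <-> BA2 p).
Proof.
move=> H; have [_ /(_ _ cone_axioms)] := (H idem_V2).2 BA2_idem_V2.
move=> /(_ (fun=> cone_nat 0)) idem.
by have [a] := wild_V2_not_idem; apply; exact: idem a.
Qed.
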